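(* Let $\mathcal{V}_{em}$ be an em-family in $\mathcal{W}(\mathcal{X},\mathcal{D})$, let $P,P'\in\mathcal{W}(\mathcal{X},\mathcal{D})$, and let $P_m$ (resp. $P'_m$) be the m-projection of $P$ (resp. $P'$) onto $\mathcal{V}_{em}$. Suppose that the four-point property holds for the quadruple $(P,P',\mathcal{V}_{em},P'_m)$. Then $$D(P'_m\|P_m)\le D(P'\|P).$$
   Context: $\mathcal{X}$ is finite with at least two elements, $(\mathcal{X},\mathcal{D})$ is a strongly connected digraph, $\mathcal{W}(\mathcal{X},\mathcal{D})$ is the set of row-stochastic matrices on $\mathcal{X}$ strictly positive on $\mathcal{D}$ and zero outside. Each $P\in\mathcal{W}(\mathcal{X},\mathcal{D})$ has stationary distribution $\pi$ and edge measure $Q(x,x')=\pi(x)P(x,x')$. $D(P\|P')=\sum_{(x,x')\in\mathcal{D}}\pi(x)P(x,x')\log\frac{P(x,x')}{P'(x,x')}$, with $\pi$ the stationary distribution of $P$. $\mathcal{F}(\mathcal{X},\mathcal{D})$ is the space of real functions on $\mathcal{X}^2$ vanishing outside $\mathcal{D}$. e-family in $\mathcal{W}(\mathcal{X},\mathcal{D})$: a family $\{P_\theta:\theta\in\mathbb{R}^d\}\subset\mathcal{W}(\mathcal{X},\mathcal{D})$ for which there exist $K,g_1,\dots,g_d\in\mathcal{F}(\mathcal{X},\mathcal{D})$ and functions $R\colon\mathbb{R}^d\times\mathcal{X}\to\mathbb{R}$, $\psi\colon\mathbb{R}^d\to\mathbb{R}$ with $\log P_\theta(x,x')=K(x,x')+\sum_{i=1}^d\theta^ig_i(x,x')+R(\theta,x')-R(\theta,x)-\psi(\theta)$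 for all $(x,x')\in\mathcal{D}$, with $g_1,\dots,g_d$ linearly independent modulo functions of the form $(x,x')\mapsto f(x')-f(x)+c$ on $\mathcal{D}$. m-family in $\mathcal{W}(\mathcal{X},\mathcal{D})$: a family for which there exist $C,F_1,\dots,F_d\in\mathcal{F}(\mathcal{X},\mathcal{D})$ with $C,C+F_1,\dots,C+F_d$ affinely independent, $\sum_{\mathcal{D}}C=1$, $\sum_{\mathcal{D}}F_i=0$, such that the family equals $\{P_\xi\in\mathcal{W}(\mathcal{X},\mathcal{D}):Q_\xi=C+\sum_i\xi^iF_i,\ \xi\in\Xi\}$, $\Xi=\{\xi\in\mathbb{R}^d:Q_\xi>0\text{ on }\mathcal{D}\}$, $Q_\xi$ being the edge measure of $P_\xi$. em-family (doubly autoparallel submanifold): a subset of $\mathcal{W}(\mathcal{X},\mathcal{D})$ that is both an e-family and an m-family (possibly with different parametrizations). The m-projection of $P$ onto $\mathcal{C}$ is $\operatorname{arg\,min}_{\bar P\in\mathcal{C}}D(P\|\bar P)$. For $P,P'\in\mathcal{W}(\mathcal{X},\mathcal{D})$ and $\bar P\in\mathcal{C}$, the four-point property holds for the quadruple $(P,P',\mathcal{C},\bar P)$ if $D(P'\|P_0)\le D(P'\|\bar P)+D(P'\|P)$, where $P_0=\operatorname{arg\,min}_{\tilde P\in\mathcal{C}}D(P\|\tilde P)$. *)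

(* Defs.v *)
From HB Require Import structures.
From mathcomp Require Import all_boot all_order all_algebra.
From mathcomp Require Import all_classical all_reals all_analysis.

Set Implicit Arguments.
Unset Strict Implicit.
Unset Printing Implicit Defensive.

Import Order.TTheory GRing.Theory Num.Theory.

Local Open Scope classical_set_scope.
Local Open Scope ring_scope.

Section MarkovFamilies.
Variables (R : realType) (X : finType).

(* Real functions on X^2, in particular transition kernels, are finite
   functions on pairs: P (x, x') is the probability of moving from x to x'.
   The edge set D is a subset of X^2; self-loops are allowed. *)

Definition strongly_connected (D : {set X * X}) : Prop :=
  forall x x' : X, connect [rel y z | (y, z) \in D] x x'.

Definition functions_on (D : {set X * X}) : set {ffun X * X -> R} :=
  [set g | forall e, e \notin D -> g e = 0].

Definition kernels (D : {set X * X}) : set {ffun X * X -> R} :=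
  [set P | [/\ forall e, e \in D -> 0 < P e,
               forall e, e \notin D -> P e = 0
             & forall x, \sum_x' P (x, x') = 1]].

Definition is_stationary (P : {ffun X * X -> R}) (p : {ffun X -> R}) : Prop :=
  [/\ forall x, 0 <= p x,
      \sum_x p x = 1
    & forall x', \sum_x p x * P (x, x') = p x'].

(* For P in kernels D with D strongly connected, the stationary distribution
   exists and is unique; the default value 0 is irrelevant in that case. *)
Definition stationary (P : {ffun X * X -> R}) : {ffun X -> R} :=
  xget 0 [set p | is_stationary P p].

Definition edge_measure (P : {ffun X * X -> R}) : {ffun X * X -> R} :=
  [ffun e => stationary P e.1 * P e].

Definition divergence (D : {set X * X}) (P P' : {ffun X * X -> R}) : R :=
  \sum_(e in D) stationary P e.1 * P e * ln (P e / P' e).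

(* Linear independence modulo the functions f(x') - f(x) + c on D. *)
Definition free_mod_coboundaries (D : {set X * X}) (d : nat)
    (g : 'I_d -> {ffun X * X -> R}) : Prop :=
  forall (a : 'I_d -> R) (f : X -> R) (c : R),
    (forall x x', (x, x') \in D ->
       \sum_(i < d) a i * g i (x, x') = f x' - f x + c) ->
    forall i, a i = 0.

Definition affinely_independent (n : nat)
    (v : 'I_n -> {ffun X * X -> R}) : Prop :=
  forall a : 'I_n -> R,
    \sum_(i < n) a i = 0 -> \sum_(i < n) a i *: v i = 0 -> forall i, a i = 0.

(* The family (C, C + F_1, ..., C + F_d). *)
Definition affine_frame (d : nat) (C : {ffun X * X -> R})
    (F : 'I_d -> {ffun X * X -> R}) : 'I_d.+1 -> {ffun X * X -> R} :=
  fun i => if unlift ord0 i is Some j then C + F j else C.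

Definition e_family (D : {set X * X}) (V : set {ffun X * X -> R}) : Prop :=
  exists (d : nat) (Pt : 'rV[R]_d -> {ffun X * X -> R})
         (K : {ffun X * X -> R}) (g : 'I_d -> {ffun X * X -> R})
         (r : 'rV[R]_d -> X -> R) (psi : 'rV[R]_d -> R),
    [/\ V = range Pt /\ V `<=` kernels D,
        functions_on D K,
        forall i, functions_on D (g i),
        free_mod_coboundaries D g
      & forall theta x x', (x, x') \in D ->
          ln (Pt theta (x, x')) =
            K (x, x') + \sum_(i < d) theta ord0 i * g i (x, x')
            + r theta x' - r theta x - psi theta].

Definition m_family (D : {set X * X}) (V : set {ffun X * X -> R}) : Prop :=
  exists (d : nat) (C : {ffun X * X -> R}) (F : 'I_d -> {ffun X * X -> R}),
    [/\ functions_on D C /\ (forall i, functions_on D (F i)),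
        affinely_independent (affine_frame C F),
        \sum_(e in D) C e = 1,
        forall i, \sum_(e in D) F i e = 0
      & V = [set P | kernels D P /\
              exists xi : 'rV[R]_d,
                let Q := C + \sum_(i < d) xi ord0 i *: F i in
                (forall e, e \in D -> 0 < Q e) /\ edge_measure P = Q]].

Definition em_family (D : {set X * X}) (V : set {ffun X * X -> R}) : Prop :=
  e_family D V /\ m_family D V.

Definition m_projection (D : {set X * X}) (V : set {ffun X * X -> R})
    (P Pm : {ffun X * X -> R}) : Prop :=
  V Pm /\ forall Pb, V Pb -> divergence D P Pm <= divergence D P Pb.

Definition four_point (D : {set X * X}) (P P' : {ffun X * X -> R})
    (V : set {ffun X * X -> R}) (Pb : {ffun X * X -> R}) : Prop :=
  exists2 P0, m_projection D V P P0 &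
    divergence D P' P0 <= divergence D P' Pb + divergence D P' P.

End MarkovFamilies.

(* Main.v *)
(** Only the e-family half of the hypothesis on V matters. Along an e-geodesic
    in V through the m-projection Pm of P,
    [ln (p_t / Pm) = t G + coboundary - c_t], and minimality of [D(P||Pm)]
    forces [E_P G = E_Pm G]. This is the Pythagorean identity
    [D(P||P1) = D(P||Pm) + D(Pm||P1)] for P1 in V, which makes the m-projection
    unique and turns the four-point inequality into the claim.

    The first-order condition is obtained without differentiating the Perron
    eigenvalue: [D(Pm||p_t) = O(t)] bounds [p_t - Pm] by a Hellinger-type
    inequality, and the Poisson equation of Pm transfers this bound to
    [E_{p_t} G - E_Pm G]. *)

Require Import Defs.
From mathcomp Require Import all_boot all_order all_algebra.
From mathcomp Require Import all_classical all_reals all_analysis.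
From mathcomp Require Import ring lra.

Set Implicit Arguments.
Unset Strict Implicit.
Unset Printing Implicit Defensive.

Import Order.TTheory GRing.Theory Num.Theory.
Local Open Scope ring_scope.

(** * Linear algebra on a finite set and scalar entropy bounds *)

Lemma fredholm_alternative (F : fieldType) (X : finType) (M : X -> X -> F) :
  (exists v : X -> F,
     (exists x, v x != 0) /\ forall y, \sum_x v x * M x y = 0) \/
  (forall f : X -> F, exists h, forall x, \sum_y M x y * h y = f x).
Proof.
pose A : 'M[F]_(#|X|) := \matrix_(i, j) M (enum_val i) (enum_val j).
have sumE (G : X -> F) : \sum_x G x = \sum_(i < #|X|) G (enum_val i).
  by rewrite (reindex _ (onW_bij _ (@enum_val_bij X))).
case: (boolP (A \in unitmx)) => [Au|]; last first.
  rewrite unitmxE unitfE negbK => /det0P[v v0 vA]; left.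
  exists (fun x => v ord0 (enum_rank x)); split.
    have /rV0Pn[i vi] := v0.
    by exists (enum_val i); rewrite enum_valK.
  move=> y; have /matrixP/(_ ord0 (enum_rank y)) := vA.
  rewrite !mxE => vAy; rewrite -[RHS]vAy sumE; apply: eq_bigr => i _.
  by rewrite mxE enum_valK enum_rankK.
right=> f; pose b : 'cV[F]_(#|X|) := \col_i f (enum_val i).
exists (fun x => (invmx A *m b) (enum_rank x) ord0) => x.
have /matrixP/(_ (enum_rank x) ord0) := mulKVmx Au b.
rewrite !mxE enum_rankK => <-; rewrite sumE; apply: eq_bigr => i _.
by rewrite !mxE enum_valK enum_rankK.
Qed.

Lemma sum_mul_delta (R : pzSemiRingType) (X : finType) (v : X -> R) (y : X) :
  \sum_x v x * (x == y)%:R = v y.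
Proof.
rewrite (bigD1 y)//= eqxx mulr1 big1 ?addr0// => x /negPf->.
by rewrite mulr0.
Qed.

Lemma sum_delta_mul (R : pzSemiRingType) (X : finType) (v : X -> R) (x : X) :
  \sum_y (x == y)%:R * v y = v x.
Proof.
rewrite (bigD1 x)//= eqxx mul1r big1 ?addr0// => y.
by rewrite eq_sym => /negPf->; rewrite mul0r.
Qed.

Lemma ln_le_subr1 (R : realType) (x : R) : 0 < x -> ln x <= x - 1.
Proof.
move=> x0; have := @le_ln1Dx R (x - 1); rewrite [1 + _]addrC subrK; apply; lra.
Qed.

(* With [- ln s >= 2 (1 - sqrt s)] at [s = q / p], the right-hand side is at
   least the Hellinger term [(sqrt p - sqrt q)^2]. *)
Lemma relative_entropy_term_ge (R : realType) (p q : R) :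
  0 < p <= 1 -> 0 < q <= 1 -> (p - q) ^+ 2 / 4 <= p * ln (p / q) - p + q.
Proof.
move=> /andP[p0 p1] /andP[q0 q1].
pose a := Num.sqrt p; pose b := Num.sqrt q.
have pE : p = a ^+ 2 by rewrite sqr_sqrtr // ltW.
have qE : q = b ^+ 2 by rewrite sqr_sqrtr // ltW.
have a0 : 0 < a by rewrite sqrtr_gt0.
have b0 : 0 < b by rewrite sqrtr_gt0.
have a1 : a <= 1 by rewrite -sqrtr1 ler_wsqrtr.
have b1 : b <= 1 by rewrite -sqrtr1 ler_wsqrtr.
have lnE : ln (p / q) = - 2 * ln (b / a).
  rewrite pE qE -expr_div_n lnXn ?divr_gt0// -(invf_div a b).
  by rewrite lnV ?posrE ?divr_gt0// mulNr mulrN opprK mulr_natl.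
have key : ln (b / a) <= b / a - 1 by apply: ln_le_subr1; rewrite divr_gt0.
have : a ^+ 2 * ln (b / a) <= a * b - a ^+ 2.
  have -> : a * b - a ^+ 2 = a ^+ 2 * (b / a - 1) by field; rewrite gt_eqF.
  by rewrite ler_pM2l // exprn_gt0.
rewrite lnE pE qE => h.
(* The factor 4 enters here: [p - q = (a - b) * (a + b)], and [a], [b] are at most 1. *)
have h2 : (a + b) ^+ 2 <= 4 by nra.
have h3 : (a - b) ^+ 2 * (a + b) ^+ 2 <= (a - b) ^+ 2 * 4.
  by rewrite ler_wpM2l // sqr_ge0.
nra.
Qed.

(** * Invariant vectors, the stationary distribution and the Poisson equation *)

Section Kernels.
Variables (R : realType) (X : finType) (D : {set X * X}).
Implicit Types P : {ffun X * X -> R}.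

Lemma kernel_ge0 P e : kernels D P -> 0 <= P e.
Proof.
by move=> [P0 Pn _]; case: (boolP (e \in D)) => [/P0/ltW|/Pn->].
Qed.

Lemma kernel_le1 P e : kernels D P -> P e <= 1.
Proof.
move=> kP; have [_ _ /(_ e.1) <-] := kP.
rewrite (bigD1 e.2)//= -surjective_pairing lerDl sumr_ge0// => y _.
exact: kernel_ge0 kP.
Qed.

Lemma kernel_sum_invariant P (v : X -> R) : kernels D P ->
  \sum_y \sum_x v x * P (x, y) = \sum_x v x.
Proof.
move=> [_ _ P1]; rewrite exchange_big/=; apply: eq_bigr => x _.
by rewrite -mulr_sumr P1 mulr1.
Qed.

(* The triangle inequality gives [|v| <= |v| P], and both sides have the same
   total mass. *)
Lemma invariant_norm P (v : X -> R) : kernels D P ->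
  (forall y, \sum_x v x * P (x, y) = v y) ->
  forall y, \sum_x `|v x| * P (x, y) = `|v y|.
Proof.
move=> kP vP.
have le y : 0 <= \sum_x `|v x| * P (x, y) - `|v y|.
  rewrite subr_ge0 -{1}vP; apply: le_trans (ler_norm_sum _ _ _) _.
  apply: ler_sum => x _; rewrite normrM (ger0_norm (kernel_ge0 _ kP))//.
have eq0 : \sum_y (\sum_x `|v x| * P (x, y) - `|v y|) = 0.
  by rewrite sumrB kernel_sum_invariant// subrr.
move=> y; apply/eqP; rewrite -subr_eq0; apply/eqP.
exact: (psumr_eq0P (fun y _ => le y) eq0).
Qed.

Hypothesis scD : strongly_connected D.

(** Positivity travels along edges: invariance gives [v z >= v y * P (y, z) > 0], and strong
    connectivity reaches every vertex. *)
Lemma invariant_gt0 P (v : X -> R) : kernels D P ->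
  (forall x, 0 <= v x) -> (forall y, \sum_x v x * P (x, y) = v y) ->
  (exists x, 0 < v x) -> forall x, 0 < v x.
Proof.
move=> kP v0 vP [x0 vx0] x.
have /connectP[s + ->] := scD x0 x.
elim: s x0 vx0 => //= z s IH y vy /andP[yz zs]; apply: IH zs.
rewrite -vP (bigD1 y)//=; apply: ltr_wpDr.
  by apply: sumr_ge0 => w _; rewrite mulr_ge0// (kernel_ge0 _ kP).
by rewrite mulr_gt0//; have [P0 _ _] := kP; exact: P0.
Qed.

(** An invariant [w] cannot change sign: [|w| + w] is invariant and nonnegative, positive where [w]
    is and zero where [w] is negative, against [invariant_gt0]. A vector of constant sign with zero
    sum vanishes. *)
Lemma invariant_sum0 P (v : X -> R) : kernels D P ->
  (forall y, \sum_x v x * P (x, y) = v y) -> \sum_x v x = 0 ->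
  forall x, v x = 0.
Proof.
move=> kP vP vs0.
have pos (w : X -> R) : (forall y, \sum_x w x * P (x, y) = w y) ->
    forall x y, 0 < w x -> 0 <= w y.
  move=> wP x y wx; rewrite leNgt; apply/negP => wy.
  pose u z := `|w z| + w z.
  have uP z : \sum_x u x * P (x, z) = u z.
    rewrite /u -(invariant_norm kP wP) -(wP z) -big_split/=.
    by apply: eq_bigr => t _; rewrite mulrDl.
  have u0 z : 0 <= u z by rewrite /u -lerBlDr sub0r -normrN ler_norm.
  have : 0 < u y.
    by apply: (invariant_gt0 kP u0 uP); exists x; rewrite /u gtr0_norm// addr_gt0.
  by rewrite /u ltr0_norm// addNr ltxx.
have vNP y : \sum_x - v x * P (x, y) = - v y.
  by rewrite -vP -sumrN; apply: eq_bigr => x _; rewrite mulNr.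
move=> x; case: (ltgtP (v x) 0) => // vx.
- have h y : 0 <= - v y.
    by apply: (pos _ vNP x y); rewrite oppr_gt0.
  have s0 : \sum_y - v y = 0 by rewrite sumrN vs0 oppr0.
  by apply/eqP; rewrite -oppr_eq0; apply/eqP; exact: (psumr_eq0P (fun y _ => h y) s0).
- exact: (psumr_eq0P (fun y _ => pos _ vP x y vx) vs0).
Qed.

(** The alternative for [P - I] gives either an invariant vector, whose normalized absolute value is
    stationary, or a solution of [P h = h + 1], which the maximum principle excludes. *)
Lemma stationaryP P : (0 < #|X|)%N -> kernels D P ->
  is_stationary P (stationary P).
Proof.
move=> /card_gt0P[x0 _] kP.
have [_ _ P1] := kP.
have sumE (v : X -> R) y : \sum_x v x * (P (x, y) - (x == y)%:R) =
    \sum_x v x * P (x, y) - v y.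
  by under eq_bigr do rewrite mulrBr; rewrite sumrB sum_mul_delta.
have [[v [[z vz] vM]]|/(_ (fun=> 1))[h hM]] :=
    fredholm_alternative (fun x y => P (x, y) - (x == y)%:R).
  have vP y : \sum_x v x * P (x, y) = v y.
    by apply/eqP; rewrite -subr_eq0 -sumE// vM.
  pose s := \sum_x `|v x|.
  have s0 : 0 < s.
    rewrite /s (bigD1 z)//= ltr_pwDl ?normr_gt0// sumr_ge0// => x _.
  rewrite /stationary; apply: (@xgetPex _ 0 [set p | is_stationary P p]%classic).
  exists [ffun x => `|v x| / s]; split.
  - by move=> x; rewrite ffunE divr_ge0// ltW.
  - under eq_bigr do rewrite ffunE.
    by rewrite -mulr_suml divff// gt_eqF.
  - move=> y; rewrite ffunE -(invariant_norm kP vP) mulr_suml.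
    by apply: eq_bigr => x _; rewrite ffunE mulrAC.
(* [P h = h + 1] is impossible at a maximum of [h] *)
exfalso.
have [x hx] : exists x, forall y, h y <= h x.
  by case: (@arg_maxP _ _ _ x0 predT h erefl) => x _ mx; exists x => y; exact: mx.
have := hM x; under eq_bigr do rewrite mulrBl.
rewrite sumrB sum_delta_mul => hE.
have : \sum_y P (x, y) * h y <= h x.
  rewrite -[leRHS]mul1r -(P1 x) mulr_suml; apply: ler_sum => y _.
  by rewrite ler_wpM2l// (kernel_ge0 _ kP).
lra.
Qed.

Hypothesis X0 : (0 < #|X|)%N.

Lemma stationary_gt0 P x : kernels D P -> 0 < stationary P x.
Proof.
move=> kP; have [p0 p1 pP] := stationaryP X0 kP.
apply: (invariant_gt0 kP p0 pP); apply/not_existsP => h.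
have : \sum_x stationary P x = 0.
  apply: big1 => y _; apply/eqP; rewrite eq_le p0 andbT leNgt.
  by apply/negP; exact: h.
by rewrite p1; apply/eqP; exact: oner_neq0.
Qed.

Lemma stationary_le1 P x : kernels D P -> stationary P x <= 1.
Proof.
move=> kP; have [p0 <- _] := stationaryP X0 kP.
by rewrite (bigD1 x)//= lerDl sumr_ge0.
Qed.

(** [P - I] is singular, but adding the all-ones matrix makes it invertible: summing a left null
    vector's equation over [y] shows that its sum is zero, so it is invariant and vanishes. *)
Lemma poisson_equation P (f : X -> R) : kernels D P ->
  exists (h : X -> R) (c : R),
    forall x, \sum_y P (x, y) * h y - h x + f x = c.
Proof.
move=> kP; have [_ _ P1] := kP.
have [[v [[z vz] vM]]|/(_ (fun x => - f x))[h hM]] :=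
    fredholm_alternative (fun x y => P (x, y) - (x == y)%:R + 1).
  exfalso.
  have sumE y : \sum_x v x * P (x, y) - v y + \sum_x v x = 0.
    rewrite -[RHS](vM y); under [RHS]eq_bigr do rewrite mulrDr mulrBr mulr1.
    by rewrite big_split sumrB /= sum_mul_delta.
  have s0 : \sum_x v x = 0.
    have : \sum_y (\sum_x v x * P (x, y) - v y + \sum_x v x) = 0.
      by apply: big1 => y _.
    rewrite big_split sumrB/= kernel_sum_invariant// subrr add0r sumr_const.
    by move/eqP; rewrite mulrn_eq0 => /orP[|/eqP//]; rewrite eqn0Ngt X0.
  have vP y : \sum_x v x * P (x, y) = v y.
    by apply/eqP; rewrite -subr_eq0; have := sumE y; rewrite s0 addr0 => ->.
  by move: vz; rewrite (invariant_sum0 kP vP s0) eqxx.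
(* The all-ones matrix contributes the sum of [h] in every row, which becomes the constant. *)
exists h, (- \sum_y h y) => x.
rewrite -[f x]opprK -hM.
under [in X in _ - X]eq_bigr do rewrite mulrDl mulrBl mul1r.
rewrite big_split sumrB/= sum_delta_mul; ring.
Qed.

(** * Expectations under the edge measure, and divergence *)

Definition edge_mean P (f : X * X -> R) : R :=
  \sum_e stationary P e.1 * P e * f e.

Lemma edge_meanD P f g :
  edge_mean P (fun e => f e + g e) = edge_mean P f + edge_mean P g.
Proof. by rewrite -big_split; apply: eq_bigr => e _; rewrite /= mulrDr. Qed.

Lemma edge_meanZ P a f : edge_mean P (fun e => a * f e) = a * edge_mean P f.
Proof. by rewrite mulr_sumr; apply: eq_bigr => e _; rewrite mulrCA. Qed.

Lemma edge_mean_pair P (f : X * X -> R) :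
  edge_mean P f = \sum_x stationary P x * \sum_y P (x, y) * f (x, y).
Proof.
under [RHS]eq_bigr do rewrite mulr_sumr.
rewrite pair_big/=; apply: eq_bigr => -[x y] _ /=; by rewrite mulrA.
Qed.

Lemma edge_mean_cst P c : kernels D P -> edge_mean P (fun=> c) = c.
Proof.
move=> kP; have [_ _ P1] := kP; have [_ p1 _] := stationaryP X0 kP.
rewrite edge_mean_pair; under eq_bigr do rewrite -mulr_suml P1 mul1r.
by rewrite -mulr_suml p1 mul1r.
Qed.

(** By stationarity both endpoints of a random edge have the same law. *)
Lemma edge_mean_coboundary P (h : X -> R) : kernels D P ->
  edge_mean P (fun e => h e.2 - h e.1) = 0.
Proof.
move=> kP; have [_ _ P1] := kP; have [_ _ pP] := stationaryP X0 kP.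
rewrite edge_mean_pair /=; under eq_bigr do under eq_bigr do rewrite mulrBr.
under eq_bigr do rewrite sumrB -mulr_suml P1 mul1r mulrBr.
rewrite sumrB; apply/eqP; rewrite subr_eq0; apply/eqP.
under eq_bigr do rewrite mulr_sumr.
rewrite exchange_big /=; apply: eq_bigr => y _.
by rewrite -[in RHS]pP mulr_suml; apply: eq_bigr => x _; rewrite mulrA.
Qed.

Lemma edge_mean_log_ratio P t f h c : kernels D P ->
  edge_mean P (fun e => t * f e + (h e.2 - h e.1) - c) = t * edge_mean P f - c.
Proof.
move=> kP; rewrite 2!edge_meanD edge_meanZ edge_mean_coboundary//.
by rewrite edge_mean_cst// addr0.
Qed.

Lemma eq_edge_mean P f g : kernels D P ->
  (forall e, e \in D -> f e = g e) -> edge_mean P f = edge_mean P g.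
Proof.
move=> [_ Pn _] fg; apply: eq_bigr => e _.
by case: (boolP (e \in D)) => [/fg->//|/Pn->]; rewrite mulr0 !mul0r.
Qed.

Lemma norm_edge_mean_le P f M : kernels D P ->
  (forall e, `|f e| <= M) -> `|edge_mean P f| <= M.
Proof.
move=> kP fM; rewrite -(edge_mean_cst M kP).
apply: le_trans (ler_norm_sum _ _ _) _; apply: ler_sum => e _.
have w0 : 0 <= stationary P e.1 * P e.
  by rewrite mulr_ge0 ?(kernel_ge0 _ kP)// ltW// stationary_gt0.
by rewrite normrM (ger0_norm w0) ler_wpM2l.
Qed.

Lemma divergenceE P P' : kernels D P ->
  divergence D P P' = edge_mean P (fun e => ln (P e / P' e)).
Proof.
move=> [_ Pn _]; rewrite /divergence big_mkcond; apply: eq_bigr => e _.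
by case: ifPn => [//|/Pn->]; rewrite mulr0 mul0r.
Qed.

(** Rows of both kernels sum to 1, so adding [P' e - P e] to each term leaves the divergence
    unchanged while making every term nonnegative; a single one can then be kept. *)
Lemma divergence_ge_term P P' e : kernels D P -> kernels D P' ->
  stationary P e.1 * ((P e - P' e) ^+ 2 / 4) <= divergence D P P'.
Proof.
move=> kP kP'.
have [P0 Pn P1] := kP; have [P0' Pn' P1'] := kP'.
pose T (e : X * X) := P e * ln (P e / P' e) - P e + P' e.
have Tge e' : (P e' - P' e') ^+ 2 / 4 <= T e'.
  case: (boolP (e' \in D)) => [e'D|e'D].
    by apply: relative_entropy_term_ge;
      rewrite ?P0 ?P0'//= ?(kernel_le1 _ kP) ?(kernel_le1 _ kP').
  by rewrite /T Pn// Pn'//; lra.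
have -> : divergence D P P' = \sum_e stationary P e.1 * T e.
  rewrite divergenceE// edge_mean_pair.
  have -> : \sum_e stationary P e.1 * T e =
      \sum_x stationary P x * \sum_y T (x, y).
    under [RHS]eq_bigr do rewrite mulr_sumr.
    by rewrite pair_big/=; apply: eq_bigr => -[x y].
  apply: eq_bigr => x _; congr (_ * _).
  by rewrite big_split sumrB/= P1 P1' subrK.
rewrite (bigD1 e)//=; apply: ler_wpDr.
  apply: sumr_ge0 => e' _; rewrite mulr_ge0//; first exact/ltW/stationary_gt0.
  by apply: le_trans (Tge e'); rewrite divr_ge0// sqr_ge0.
by rewrite ler_wpM2l// ltW// stationary_gt0.
Qed.

Lemma divergence_ge0 P P' : kernels D P -> kernels D P' ->
  0 <= divergence D P P'.
Proof.
move=> kP kP'; have /card_gt0P[x _] := X0.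
apply: le_trans (divergence_ge_term (x, x) kP kP').
by rewrite mulr_ge0 ?divr_ge0 ?sqr_ge0//; exact/ltW/stationary_gt0.
Qed.

Lemma divergence_le0_eq P P' : kernels D P -> kernels D P' ->
  divergence D P P' <= 0 -> P = P'.
Proof.
move=> kP kP' d0; apply/ffunP => e.
have := le_trans (divergence_ge_term e kP kP') d0.
rewrite pmulr_rle0 ?stationary_gt0// pmulr_lle0 ?invr_gt0//.
rewrite le_eqVlt ltNge sqr_ge0 orbF sqrf_eq0 subr_eq0.
by move/eqP.
Qed.

(** * First-order condition along an e-geodesic *)

Lemma edge_mean_perturbation P (G : X * X -> R) : kernels D P ->
  exists2 C : R, 0 <= C & forall P', kernels D P' ->
    (edge_mean P' G - edge_mean P G) ^+ 2 <= C * divergence D P P'.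
Proof.
move=> kP; have [_ _ P1] := kP.
have [h [c hc]] := poisson_equation (fun x => \sum_y P (x, y) * G (x, y)) kP.
(* The Poisson solution makes all row means of [H] under [P] equal to [c], and a coboundary changes
   no edge mean. *)
pose H e := G e + (h e.2 - h e.1).
have HP x : \sum_y P (x, y) * H (x, y) = c.
  rewrite -(hc x) /H/=.
  under eq_bigr do rewrite mulrDr mulrBr.
  by rewrite big_split sumrB/= -mulr_suml P1 mul1r addrC.
have GH P' : kernels D P' -> edge_mean P' G = edge_mean P' H.
  by move=> kP'; rewrite /H edge_meanD edge_mean_coboundary// addr0.
have Pc : edge_mean P H = c.
  have [_ p1 _] := stationaryP X0 kP.
  rewrite edge_mean_pair; under eq_bigr do rewrite HP.
  by rewrite -mulr_suml p1 mul1r.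
(* The square roots come from solving [divergence_ge_term] for [|P' e - P e|]; [S] depends on [P]
   and [G] only. *)
pose S := \sum_e `|H e| * Num.sqrt (4 / stationary P e.1).
exists (S ^+ 2); first exact: sqr_ge0.
move=> P' kP'; have [_ _ P1'] := kP'.
have d0 := divergence_ge0 kP kP'.
set d := divergence D P P' in d0 *.
have dP e : `|P' e - P e| <= Num.sqrt (4 / stationary P e.1) * Num.sqrt d.
  have p0 := stationary_gt0 e.1 kP.
  have p40 : 0 <= 4 / stationary P e.1 by rewrite divr_ge0// ltW.
  rewrite -sqrtrM// -sqrtr_sqr; apply: ler_wsqrtr.
  have := divergence_ge_term e kP kP'; rewrite -/d => hd.
  rewrite mulrAC ler_pdivlMr//; nra.
(* Averaging the constant row means of [H] under [stationary P'] also gives [c], so the change of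
   stationary distribution drops out and only [P' - P] remains. *)
have -> : edge_mean P' G - edge_mean P G =
    \sum_e stationary P' e.1 * ((P' e - P e) * H e).
  rewrite !GH// Pc -(edge_mean_cst c kP') edge_mean_pair edge_mean_pair.
  rewrite -sumrB.
  have -> : \sum_e stationary P' e.1 * ((P' e - P e) * H e) =
     \sum_x stationary P' x * \sum_y (P' (x, y) - P (x, y)) * H (x, y).
    under [RHS]eq_bigr do rewrite mulr_sumr.
    by rewrite pair_big/=; apply: eq_bigr => -[x y].
  apply: eq_bigr => x _; rewrite -mulrBr; congr (_ * _).
  rewrite -mulr_suml P1' mul1r -(HP x) -sumrB.
  by apply: eq_bigr => y _; rewrite mulrBl.
have le : `|\sum_e stationary P' e.1 * ((P' e - P e) * H e)| <= S * Num.sqrt d.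
  apply: le_trans (ler_norm_sum _ _ _) _; rewrite mulr_suml.
  apply: ler_sum => e _; rewrite !normrM.
  have p0 := stationary_gt0 e.1 kP'.
  rewrite (gtr0_norm p0); apply: le_trans (_ : 1 * (`|P' e - P e| * `|H e|) <= _).
    by rewrite ler_wpM2r ?mulr_ge0// stationary_le1.
  by rewrite mul1r mulrC -mulrA ler_wpM2l.
rewrite -(sqr_sqrtr d0) -exprMn -real_normK ?num_real//.
by rewrite ler_sqr ?nnegrE// (le_trans _ le).
Qed.

(* Both [t (E_{P_t} G - E_{P'} G)] and [D(P_t||P_0)] are nonnegative, and
   [D(P_0||P_t) = O(t)] makes [E_{P_t} G] continuous at [0]; letting [t] tend
   to [0] from either side gives the equality. *)
Lemma e_geodesic_moment P' (p : R -> {ffun X * X -> R}) (G : X * X -> R)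
    (r : R -> X -> R) (c : R -> R) :
  kernels D P' -> (forall t, kernels D (p t)) ->
  (forall t e, e \in D ->
     ln (p t e / p 0 e) = t * G e + (r t e.2 - r t e.1) - c t) ->
  (forall t, divergence D P' (p 0) <= divergence D P' (p t)) ->
  edge_mean P' G = edge_mean (p 0) G.
Proof.
move=> kP' kp lnp minp.
have meanE P t : kernels D P ->
    edge_mean P (fun e => ln (p t e / p 0 e)) = t * edge_mean P G - c t.
  by move=> kP; rewrite (eq_edge_mean kP (lnp t)) edge_mean_log_ratio.
have divB P t : kernels D P ->
    divergence D P (p 0) - divergence D P (p t) = t * edge_mean P G - c t.
  move=> kP; rewrite -meanE// !divergenceE//.
  apply/eqP; rewrite subr_eq -edge_meanD; apply/eqP.
  apply: eq_edge_mean => // e eD.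
  have [P0 _ _] := kP; have [p0 _ _] := kp 0; have [pt _ _] := kp t.
  by rewrite !ln_div ?posrE ?P0 ?p0 ?pt//; ring.
have div0 P : kernels D P -> divergence D P P = 0.
  move=> kP; rewrite divergenceE// -(edge_mean_cst 0 kP).
  apply: eq_edge_mean => // e eD; have [P0 _ _] := kP.
  by rewrite divff ?ln1// gt_eqF// P0.
have [C C0 hC] := edge_mean_perturbation G (kp 0).
pose M := \sum_e `|G e|.
have GM e : `|G e| <= M by rewrite /M (bigD1 e)//= lerDl sumr_ge0.
have M0 : 0 <= M by rewrite sumr_ge0.
set q' := edge_mean P' G; set q0 := edge_mean (p 0) G.
(* Minimality gives [t * q' <= c t], and [D(p t || p 0) >= 0] gives
   [c t <= t * edge_mean (p t) G]. *)
have mono t : t * q' <= t * edge_mean (p t) G.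
  have := divB P' t kP'; have := divB (p t) t (kp t); rewrite div0//.
  have := minp t; have := divergence_ge0 (kp t) (kp 0); rewrite -/q'; lra.
(* Here [D(p 0 || p t) = c t - t * q0] is at most [t * (edge_mean (p t) G - q0)], and both means are
   bounded by [M]. *)
have cont t : (edge_mean (p t) G - q0) ^+ 2 <= C * (2 * M) * `|t|.
  apply: le_trans (hC _ (kp t)) _; rewrite -mulrA ler_wpM2l//.
  have := divB (p 0) t (kp 0); have := divB (p t) t (kp t); rewrite !div0//.
  have := divergence_ge0 (kp t) (kp 0); rewrite -/q0 => h1 h2 h3.
  have : divergence D (p 0) (p t) <= t * (edge_mean (p t) G - q0) by lra.
  move=> /le_trans; apply; apply: le_trans (ler_norm _) _.
  rewrite normrM mulrC ler_wpM2r//.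
  apply: le_trans (ler_normB _ _) _.
  have := norm_edge_mean_le (kp t) GM; have := norm_edge_mean_le (kp 0) GM.
  rewrite -/q0; lra.
have lim a : 0 <= a -> (forall t, 0 < t -> a ^+ 2 <= C * (2 * M) * t) -> a = 0.
  move=> a0 h; apply/eqP; rewrite -sqrf_eq0 eq_le sqr_ge0 andbT.
  set B := C * (2 * M) in h.
  have B0 : 0 <= B by rewrite !mulr_ge0.
  apply/ler_addgt0Pr => eps eps0; rewrite add0r.
  (* [B] may be zero, hence the division by [B + 1]. *)
  have B1 : 0 < B + 1 by lra.
  apply: le_trans (h (eps / (B + 1)) _) _; first by rewrite divr_gt0.
  rewrite mulrA ler_pdivrMr//; nra.
apply/eqP; rewrite eq_le; apply/andP; split; rewrite leNgt; apply/negP => lt.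
- suff : q' - q0 = 0 by lra.
  apply: lim => [|t t0]; first by lra.
  have := cont t; rewrite gtr0_norm//; apply: le_trans.
  have := mono t; rewrite ler_pM2l// => h; nra.
- suff : q0 - q' = 0 by lra.
  apply: lim => [|t t0]; first by lra.
  have := cont (- t); rewrite normrN gtr0_norm//; apply: le_trans.
  have := mono (- t); rewrite ler_nM2l ?oppr_lt0// => h; nra.
Qed.

(** * Pythagorean identity and uniqueness of the m-projection *)

Lemma m_projection_pythagoras (V : set {ffun X * X -> R}) P Pm P1 :
  e_family D V -> kernels D P -> m_projection D V P Pm -> V P1 ->
  divergence D P P1 = divergence D P Pm + divergence D Pm P1.
Proof.
move=> [d [Pt [K [g [r [psi [[VE VD] _ _ _ lnE]]]]]]] kP [VPm minPm] VP1.
have kV Q : V Q -> kernels D Q by exact: VD.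
have kPm := kV _ VPm; have kP1 := kV _ VP1.
move: (VPm) (VP1); rewrite VE => -[th0 _ th0E] [th1 _ th1E].
(* The e-geodesic is a straight line in the natural parameter, from [Pm] at 0 to [P1] at 1. *)
pose th t := th0 + t *: (th1 - th0).
have th_0 : th 0 = th0 by rewrite /th scale0r addr0.
have th_1 : th 1 = th1 by rewrite /th scale1r addrC subrK.
pose p t := Pt (th t).
have Vp t : V (p t) by rewrite VE; exists (th t).
have p0E : p 0 = Pm by rewrite /p th_0.
have p1E : p 1 = P1 by rewrite /p th_1.
pose G e := \sum_(i < d) (th1 - th0) ord0 i * g i e.
pose rr t x := r (th t) x - r th0 x.
pose cc t := psi (th t) - psi th0.
have lnp t e : e \in D ->
    ln (p t e / p 0 e) = t * G e + (rr t e.2 - rr t e.1) - cc t.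
  case: e => x y eD /=.
  have [pt0 _ _] := kV _ (Vp t); have [p00 _ _] := kV _ (Vp 0).
  rewrite ln_div ?posrE ?pt0 ?p00// /p !lnE// th_0 /rr /cc.
  have -> : \sum_(i < d) th t ord0 i * g i (x, y) =
      \sum_(i < d) th0 ord0 i * g i (x, y) + t * G (x, y).
    rewrite mulr_sumr -big_split/=; apply: eq_bigr => i _.
    by rewrite !mxE; ring.
  ring.
have GE : edge_mean P G = edge_mean (p 0) G.
  apply: (e_geodesic_moment kP (fun t => kV _ (Vp t)) lnp) => t.
  by rewrite p0E; exact: minPm.
have meanE Q : kernels D Q ->
    edge_mean Q (fun e => ln (P1 e / Pm e)) = edge_mean Q G - cc 1.
  move=> kQ; have := lnp 1; rewrite p1E p0E => lnp1.
  by rewrite (eq_edge_mean kQ lnp1) edge_mean_log_ratio// mul1r.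
(* This mean under [P] is [D(P||Pm) - D(P||P1)], and under [Pm] it is [- D(Pm||P1)]; their equality
   is the Pythagorean identity. *)
have eqm : edge_mean P (fun e => ln (P1 e / Pm e)) =
    edge_mean Pm (fun e => ln (P1 e / Pm e)) by rewrite !meanE// GE p0E.
have [P0 _ _] := kP; have [P10 _ _] := kP1; have [Pm0 _ _] := kPm.
rewrite !divergenceE//.
have -> : edge_mean Pm (fun e => ln (Pm e / P1 e)) =
    -1 * edge_mean P (fun e => ln (P1 e / Pm e)).
  rewrite eqm -edge_meanZ; apply: eq_edge_mean => // e eD.
  by rewrite !ln_div ?posrE ?P10 ?Pm0//; ring.
rewrite -edge_meanZ -edge_meanD; apply: eq_edge_mean => // e eD.
by rewrite !ln_div ?posrE ?P0 ?P10 ?Pm0//; ring.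
Qed.

(** The Pythagorean identity at the second minimizer leaves [D(Pm||Pm') <= 0]. *)
Lemma m_projection_unique (V : set {ffun X * X -> R}) P Pm Pm' :
  e_family D V -> kernels D P -> m_projection D V P Pm ->
  m_projection D V P Pm' -> Pm = Pm'.
Proof.
move=> eV kP mP mP'.
have VD : (V `<=` kernels D)%classic by case: eV => [? [? [? [? [? [? [[]]]]]]]].
have := m_projection_pythagoras eV kP mP (proj1 mP').
have := proj2 mP' _ (proj1 mP).
move=> h1 h2; apply: divergence_le0_eq; [exact: VD mP.1|exact: VD mP'.1|lra].
Qed.

End Kernels.

Theorem proposition5p4 (R : realType) (X : finType) (D : {set X * X})
    (V : set {ffun X * X -> R}) (P P' Pm Pm' : {ffun X * X -> R})
    (cardX : (1 < #|X|)%N)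
    (scD : strongly_connected D)
    (emV : em_family D V)
    (WP : kernels D P)
    (WP' : kernels D P')
    (projP : m_projection D V P Pm)
    (projP' : m_projection D V P' Pm')
    (fourP : four_point D P P' V Pm') :
  divergence D Pm' Pm <= divergence D P' P.
Proof.
have X0 : (0 < #|X|)%N := ltnW cardX.
have [eV _] := emV; have [P0 projP0] := fourP.
(* Uniqueness identifies the projection supplied by [four_point] with [Pm]; after the Pythagorean
   identity for [P'], the term [D(P'||Pm')] cancels. *)
rewrite -(m_projection_unique scD X0 eV WP projP projP0).
rewrite (m_projection_pythagoras scD X0 eV WP' projP' (proj1 projP)).
lra.
Qed.
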